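(* The $\mathcal{C}$-Coalition Formation problem, parameterized by $\mathrm{vc}+\mathcal{C}$, admits a kernel with $\mathcal{O}(\mathrm{vc}^2\,\mathcal{C})$ vertices, where $\mathrm{vc}$ is the vertex cover number of the input graph.
   Context: $\mathcal{C}$-Coalition Formation (unweighted): the input is an undirected graph $G=(V,E)$ and a capacity $\mathcal{C}\in\mathbb{N}$. A $\mathcal{C}$-partition of $V$ is a partition $\mathcal{P}=\{C_1,\dots,C_p\}$ of $V$ with $|C_i|\le\mathcal{C}$; its value is $v(\mathcal{P})=\sum_{i}|E(G[C_i])|$; the goal is to maximize the value (decision form: decide whether a $\mathcal{C}$-partition of value at least a given $t$ exists). A kernel is a polynomial-time algorithm mapping an instance to an equivalent instance of the same problem whose size is bounded by a function of the parameter. *)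

(* Defs.v *)
From mathcomp Require Import all_boot.

Set Implicit Arguments.
Unset Strict Implicit.
Unset Printing Implicit Defensive.

(* A graph on a finite type T is a symmetric irreflexive relation e : rel T. *)
Section Graphs.

Variables (T : finType) (e : rel T).

(* Undirected edges, as two-element sets of vertices. *)
Definition edges : {set {set T}} :=
  [set A | [exists x, exists y, e x y && (A == [set x; y])]].

Definition induced_edges (C : {set T}) : {set {set T}} :=
  [set A in edges | A \subset C].

Definition vertex_cover (S : {set T}) : bool :=
  [forall x, forall y, e x y ==> (x \in S) || (y \in S)].

Definition vc : nat := #|[arg min_(S < [set: T] | vertex_cover S) #|S|]|.

Definition cpartition (cap : nat) (P : {set {set T}}) : Prop :=
  partition P [set: T] /\ forall C, C \in P -> #|C| <= cap.

Definition value (P : {set {set T}}) : nat := \sum_(C in P) #|induced_edges C|.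

End Graphs.

Record instance : Type := Instance {
  nvert : nat;
  adj : rel 'I_nvert;
  adj_sym : symmetric adj;
  adj_irr : irreflexive adj;
  capacity : nat;
  target : nat
}.

Definition yes_instance (I : instance) : Prop :=
  exists P : {set {set 'I_(nvert I)}},
    cpartition (capacity I) P /\ target I <= value (@adj I) P.

Definition vc_number (I : instance) : nat := vc (@adj I).

Definition parameter (I : instance) : nat := vc_number I + capacity I.

Definition bitlen (k : nat) : nat := (trunc_log 2 k).+1.

(* Bit size of an instance: an adjacency matrix and three binary numbers. *)
Definition instance_size (I : instance) : nat :=
  nvert I ^ 2 + bitlen (nvert I) + bitlen (capacity I) + bitlen (target I).

(* The machine model is the random access machine with logarithmic cost:     *)
(* finitely many registers (those named by the program) and an indirectly    *)
(* addressed memory, both holding natural numbers; the arithmetic consists of*)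
(* addition and truncated subtraction; every instruction is charged the bit  *)
(* lengths of all the numbers it handles, addresses included.  Running times *)
(* are polynomially related to those of Turing machines (Cook and Reckhow).  *)
(* Programs are written with structured control flow instead of jumps.       *)

Record state : Type := State { regs : nat -> nat; memory : nat -> nat }.

Inductive expr : Type :=
  | Const of nat
  | Reg of nat
  | Add of expr & expr
  | Sub of expr & expr.

Fixpoint eval (s : state) (a : expr) : nat :=
  match a with
  | Const k => k
  | Reg x => regs s x
  | Add a1 a2 => eval s a1 + eval s a2
  | Sub a1 a2 => eval s a1 - eval s a2
  end.

Fixpoint cost (s : state) (a : expr) : nat :=
  match a with
  | Const _ | Reg _ => bitlen (eval s a)
  | Add a1 a2 | Sub a1 a2 => cost s a1 + cost s a2 + bitlen (eval s a)
  end.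

Definition update (f : nat -> nat) (x v : nat) : nat -> nat :=
  fun y => if y == x then v else f y.

Definition set_reg (s : state) (x v : nat) : state :=
  State (update (regs s) x v) (memory s).

Definition set_mem (s : state) (p v : nat) : state :=
  State (regs s) (update (memory s) p v).

Inductive cmd : Type :=
  | Skip
  | Assign of nat & expr         (* reg x := a *)
  | Read of nat & expr           (* reg x := memory[a] *)
  | Write of expr & expr         (* memory[a1] := a2 *)
  | Seq of cmd & cmd
  | If of expr & cmd & cmd       (* tests a <> 0 *)
  | While of expr & cmd.         (* loops as long as a <> 0 *)

(* exec c s t s' : started in s, the program c halts in s' after time t. *)
Inductive exec : cmd -> state -> nat -> state -> Prop :=
  | ExecSkip s : exec Skip s 1 s
  | ExecAssign s x a : exec (Assign x a) s (cost s a) (set_reg s x (eval s a))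
  | ExecRead s x a :
      exec (Read x a) s (cost s a + bitlen (memory s (eval s a)))
           (set_reg s x (memory s (eval s a)))
  | ExecWrite s a1 a2 :
      exec (Write a1 a2) s (cost s a1 + cost s a2)
           (set_mem s (eval s a1) (eval s a2))
  | ExecSeq c1 c2 s1 s2 s3 t1 t2 :
      exec c1 s1 t1 s2 -> exec c2 s2 t2 s3 -> exec (Seq c1 c2) s1 (t1 + t2) s3
  | ExecIfTrue a c1 c2 s t s' :
      eval s a <> 0 -> exec c1 s t s' -> exec (If a c1 c2) s (cost s a + t) s'
  | ExecIfFalse a c1 c2 s t s' :
      eval s a = 0 -> exec c2 s t s' -> exec (If a c1 c2) s (cost s a + t) s'
  | ExecWhileDone a c s : eval s a = 0 -> exec (While a c) s (cost s a) s
  | ExecWhileStep a c s1 s2 s3 t1 t2 :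
      eval s1 a <> 0 -> exec c s1 t1 s2 -> exec (While a c) s2 t2 s3 ->
      exec (While a c) s1 (cost s1 a + t1 + t2) s3.

(* Row-major adjacency matrix, 0 outside of the matrix. *)
Definition adj_cell (I : instance) (p : nat) : nat :=
  [exists i : 'I_(nvert I), exists j : 'I_(nvert I),
     (p == i * nvert I + j) && adj i j].

Definition input_state (I : instance) : state :=
  State (nth 0 [:: nvert I; capacity I; target I]) (adj_cell I).

(* The other registers and memory cells may hold anything at the end. *)
Definition outputs (s : state) (I : instance) : Prop :=
  [/\ regs s 0 = nvert I, regs s 1 = capacity I, regs s 2 = target I
    & forall p, p < nvert I ^ 2 -> memory s p = adj_cell I p].

Definition polynomial_time (f : instance -> instance) : Prop :=
  exists (prog : cmd) (c d : nat), forall I : instance,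
    exists (t : nat) (s : state),
      [/\ exec prog (input_state I) t s, outputs s (f I)
        & t <= c * instance_size I ^ d].

(* Bounding the bit size also bounds the parameter of the output. *)
Definition kernel (f : instance -> instance) : Prop :=
  [/\ polynomial_time f,
      forall I, yes_instance (f I) <-> yes_instance I
    & exists g : nat -> nat, forall I, instance_size (f I) <= g (parameter I)].

(* Main.v *)
(** Let X be the vertex set of a maximal matching, a vertex cover with
    |X| <= 2 vc.  In any partition only the blocks meeting X carry edges, and they
    have at most |X| cap vertices together.  So a vertex v of degree greater than
    |X| cap always finds cap - 1 neighbours in edgeless blocks, and forming a
    block with them yields cap - 1 edges, the most that v can ever contribute:
    v is deleted and the target decreased by cap - 1.  Once all degrees are at
    most |X| cap, at most |X| + |X|^2 cap vertices are not isolated; only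
    those are kept, and the target is cut to one more than the square of their number.

    Values of partitions are handled by counting monochromatic ordered pairs of
    adjacent vertices for vertex labellings.  Running times come for free: if
    all loops of a program make at most N iterations and all stored values are
    at most M, its time is bounded by a polynomial in N, read off the program
    text, times the bit length of M. *)
Require Import Defs.
From Stdlib Require Import ClassicalEpsilon.
From mathcomp Require Import all_boot zify.

Set Implicit Arguments.
Unset Strict Implicit.
Unset Printing Implicit Defensive.

(** * Partitions as labellings, and the reduction rules *)

Section Labellings.

Variables (T : finType) (e : rel T).

Definition achievable (cap t : nat) : Prop :=
  exists P : {set {set T}}, cpartition cap P /\ t <= value e P.

Definition mono_pairs (L : finType) (f : T -> L) :=
  [set p | e p.1 p.2 & f p.1 == f p.2].

Definition bounded_classes (L : finType) (cap : nat) (f : T -> L) : Prop :=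
  forall l, #|[set x | f x == l]| <= cap.

Hypotheses (esym : symmetric e) (eirr : irreflexive e).

(** Fibre the pairs over their underlying sets: by irreflexivity each edge has exactly two
    orientations. *)
Lemma card_induced_edges (C : {set T}) :
  #|[set p : T * T | [&& e p.1 p.2, p.1 \in C & p.2 \in C]]|
    = 2 * #|induced_edges e C|.
Proof.
rewrite -sum1_card (partition_big (fun p => [set p.1; p.2])
  (fun A => A \in induced_edges e C)) /=; last first.
  move=> [x y]; rewrite !inE /= => /and3P[exy xC yC].
  rewrite subUset !sub1set xC yC !andbT.
  by apply/existsP; exists x; apply/existsP; exists y; rewrite exy eqxx.
rewrite mulnC -sum_nat_const; apply: eq_bigr => A.
rewrite !inE => /andP[/existsP[x /existsP[y /andP[exy /eqP ->]]]].
rewrite subUset !sub1set => /andP[xC yC].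
have nxy : x != y by apply: contraTneq exy => ->; rewrite eirr.
rewrite sum1_card -(_ : #|[set (x, y); (y, x)]| = 2); last first.
  by rewrite cards2 xpair_eqE negb_and nxy.
apply: eq_card => -[a b]; rewrite [LHS]unfold_in !inE /= !xpair_eqE.
apply/idP/idP.
  move=> /andP[/and3P[eab _ _] /eqP Eab].
  have nab : a != b by apply: contraTneq eab => ->; rewrite eirr.
  have : a \in [set x; y] by rewrite -Eab !inE eqxx.
  have : b \in [set x; y] by rewrite -Eab !inE eqxx orbT.
  move=> /set2P[] Eb /set2P[] Ea; rewrite Ea Eb ?eqxx ?orbT // in nab *.
case/orP => /andP[/eqP-> /eqP->]; rewrite xC yC ?andbT.
  by rewrite exy eqxx.
by rewrite esym exy setUC eqxx.
Qed.

(** The second hypothesis says that the classes of [f] are the blocks of [P], so a monochromatic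
    pair is charged to the block of its first entry. *)
Lemma card_mono_pairs (L : finType) (f : T -> L) (P : {set {set T}}) :
    partition P [set: T] ->
    (forall x y, (f x == f y) = (y \in pblock P x)) ->
  #|mono_pairs f| = 2 * value e P.
Proof.
move=> Ppart fP; have [/eqP cov triv _] := and3P Ppart.
have inb x : x \in pblock P x by rewrite mem_pblock cov inE.
have bP x : pblock P x \in P by apply: pblock_mem; rewrite cov inE.
rewrite /value big_distrr /=.
rewrite -sum1_card (partition_big (fun p => pblock P p.1) (fun C => C \in P)) //.
apply: eq_bigr => C CP; rewrite -card_induced_edges sum1_card.
apply: eq_card => -[x y]; rewrite [LHS]unfold_in !inE /= fP -andbA.
case: (e x y) => //=; apply/andP/andP => [[yx /eqP <-] | [xC yC]].
  by rewrite inb yx.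
by rewrite (def_pblock triv CP xC) yC eqxx.
Qed.

(** Blocks serve as labels and label classes as blocks. Letting the label type vary makes fresh
    labels available when a partition has to be modified. *)
Lemma achievableP (cap t : nat) :
  achievable cap t <->
  exists (L : finType) (f : T -> L),
    bounded_classes cap f /\ 2 * t <= #|mono_pairs f|.
Proof.
split=> [[P [[Ppart Pcap] tP]] | [L [f [fcap tf]]]].
  have [/eqP cov triv _] := and3P Ppart.
  have fP x y : (pblock P x == pblock P y) = (y \in pblock P x).
    by rewrite eq_pblock // cov inE.
  exists {set T}, (pblock P); split; last first.
    by rewrite (card_mono_pairs Ppart fP) leq_mul2l.
  move=> A; case: (set_0Vmem [set x | pblock P x == A]) => [->|[x]].
    by rewrite cards0.
  rewrite inE => /eqP Ax; apply: leq_trans (Pcap (pblock P x) _); last first.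
    by apply: pblock_mem; rewrite cov inE.
  by apply/subset_leq_card/subsetP => y; rewrite inE -Ax eq_sym fP.
pose P := preim_partition f [set: T].
have Ppart : partition P [set: T] := preim_partitionP f setT.
have eqf : {in [set: T] & &, equivalence_rel (fun x y => f x == f y)}.
  by split=> [|/eqP ->].
have fP x y : (f x == f y) = (y \in pblock P x).
  by rewrite (pblock_equivalence_partition eqf) ?inE.
exists P; split; last by rewrite (card_mono_pairs Ppart fP) leq_mul2l in tf.
split=> // C CP; have [/eqP cov triv P0] := and3P Ppart.
have /set0Pn [x xC] : C != set0 by apply: contraNneq P0 => <-.
apply: leq_trans (fcap (f x)); apply/subset_leq_card/subsetP => y yC.
by rewrite inE eq_sym fP (def_pblock triv CP xC).
Qed.

Lemma achievable_leq_sqr (cap t : nat) : achievable cap t -> t <= #|T| ^ 2.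
Proof.
case/achievableP=> L [f [_ tf]].
have: #|mono_pairs f| <= #|T| * #|T| by rewrite -card_prod max_card.
by rewrite -mulnn; lia.
Qed.

(** No value exceeds the square of the number of vertices, so all larger targets are equally
    unachievable. The truncated subtraction mirrors the test made by the program. *)
Lemma achievable_trunc (cap t : nat) :
  achievable cap (if t - #|T| ^ 2 == 0 then t else (#|T| ^ 2).+1)
    <-> achievable cap t.
Proof.
case: eqP => [//|tT]; split=> /achievable_leq_sqr; lia.
Qed.

End Labellings.

(** Deleted vertices remain as isolated ones, which keeps the vertex type fixed throughout the
    pruning. *)
Definition delete (T : finType) (e : rel T) (D : {set T}) : rel T :=
  fun x y => [&& e x y, x \notin D & y \notin D].

Lemma delete_sym (T : finType) (e : rel T) (D : {set T}) :
  symmetric e -> symmetric (delete e D).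
Proof. by move=> esym x y; rewrite /delete esym; do !case: (_ \notin _). Qed.

Lemma delete_irr (T : finType) (e : rel T) (D : {set T}) :
  irreflexive e -> irreflexive (delete e D).
Proof. by move=> eirr x; rewrite /delete eirr. Qed.

Lemma delete_set0 (T : finType) (e : rel T) : delete e set0 =2 e.
Proof. by move=> x y; rewrite /delete !inE andbT. Qed.

Lemma deleteU1 (T : finType) (e : rel T) (v : T) (D : {set T}) :
  delete e (v |: D) =2 delete (delete e D) [set v].
Proof.
by move=> x y; rewrite /delete !inE !negb_or; case: (e x y) (x \in D) (y \in D)
  => [] [] [] //=; rewrite ?andbF ?andbT.
Qed.

Lemma eq_achievable (T : finType) (e e' : rel T) (cap t : nat) :
  e =2 e' -> achievable e cap t <-> achievable e' cap t.
Proof.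
move=> ee'; suff E P : value e P = value e' P.
  by split=> -[P [H tP]]; exists P; split=> //; rewrite ?E // -E.
apply: eq_bigr => C _; apply: eq_card => A; rewrite !inE; congr (_ && _).
by apply: eq_existsb => x; apply: eq_existsb => y; rewrite ee'.
Qed.

(** * Deleting a vertex of high degree *)

Section HighDegree.

Variables (T : finType) (e : rel T) (cap : nat) (S : {set T}) (v : T).
Hypotheses (esym : symmetric e) (eirr : irreflexive e).
Hypotheses (Scover : vertex_cover e S) (cap_gt0 : 0 < cap).
Hypothesis v_high : #|S| * cap < #|[set y | e v y]|.

Let coverP x y : e x y -> (x \in S) || (y \in S).
Proof. by move=> exy; have /forallP/(_ x)/forallP/(_ y)/implyP := Scover; apply. Qed.

(** A class gives [v] at most [cap - 1] neighbours, so deletion loses no more than that. Conversely,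
    [v] has [cap - 1] neighbours that share no class with a cover vertex other than [v]; moving them
    to a new class with [v] destroys no pair. *)
Lemma achievable_delete_high (t : nat) :
  achievable e cap t <-> achievable (delete e [set v]) cap (t - (cap - 1)).
Proof.
have dsym := delete_sym [set v] esym; have dirr := @delete_irr _ _ [set v] eirr.
rewrite !achievableP //; split=> -[L [f [fcap tf]]].
  exists L, f; split=> //.
  pose B := [set y | f y == f v] :\ v.
  have vB : #|B| <= cap - 1.
    have := fcap (f v); rewrite (cardsD1 v) inE eqxx /= -/B; lia.
  suff /subset_leq_card : mono_pairs e f \subset
      mono_pairs (delete e [set v]) f
        :|: ([set (v, y) | y in B] :|: [set (y, v) | y in B]).
    move=> H; have := leq_trans H (leq_card_setU _ _).
    have [+ _] := leq_card_setU [set (v, y) | y in B] [set (y, v) | y in B].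
    have -> : #|[set (v, y) | y in B]| = #|B| by apply: card_imset => ? ? [].
    have -> : #|[set (y, v) | y in B]| = #|B| by apply: card_imset => ? ? [].
    lia.
  apply/subsetP=> -[x y]; rewrite !inE /= /delete !inE => /andP[exy fxy].
  rewrite exy fxy andbT /=.
  case: (eqVneq x v) exy fxy => [-> | nxv] exy fxy.
    apply/orP; right; apply/orP; left; apply/imsetP; exists y => //.
    by rewrite !inE [f y == _]eq_sym fxy andbT; apply: contraTneq exy => ->; rewrite eirr.
  case: (eqVneq y v) exy fxy => [-> | //] exy fxy.
  by apply/orP; right; apply/orP; right; apply/imsetP; exists x => //; rewrite !inE nxv.
(* Otherwise all neighbours of [v] would lie in [S], too few for its degree. *)
have vS : v \in S.
  apply/idPn => vS; suff : #|[set y | e v y]| <= #|S| by nia.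
  apply/subset_leq_card/subsetP => y; rewrite inE => /coverP.
  by rewrite (negPf vS).
pose dirty := \bigcup_(x in S :\ v) [set y | f y == f x].
have dirty_le : #|dirty| <= #|S :\ v| * cap.
  rewrite -sum_nat_const; apply: leq_trans (_ : \sum_(x in S :\ v)
    #|[set y | f y == f x]| <= _); last by apply: leq_sum => x _; apply: fcap.
  by rewrite /dirty; elim/big_rec2: _ => [|x A n _ IH]; rewrite ?cards0 //;
     apply: leq_trans (leq_card_setU _ _) _; rewrite leq_add2l.
(* The classes to avoid hold at most [(#|S| - 1) * cap] vertices, against a degree above
   [#|S| * cap]. *)
have free_ge : cap - 1 <= #|[set y | e v y] :\: dirty|.
  have := cardsID dirty [set y | e v y].
  have := subset_leq_card (subsetIr [set y | e v y] dirty).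
  have := cardsD1 v S; rewrite vS /= => S1.
  move: v_high; rewrite {}S1; nia.
pose D := [set y in take (cap - 1) (enum ([set y | e v y] :\: dirty))].
have D_free y : y \in D -> (y \notin dirty) /\ e v y.
  by rewrite inE => /mem_take; rewrite mem_enum !inE => /andP.
have D_card : #|D| = cap - 1.
  rewrite cardsE (card_uniqP _) ?take_uniq ?enum_uniq //.
  by rewrite size_take -cardE; case: ltnP => //; lia.
have vD : v \notin D by apply/negP => /D_free[_]; rewrite eirr.
(* [None] is the label of the new class. *)
exists (option L), (fun x => if x \in v |: D then None else Some (f x)).
split=> [[l|]|].
- apply: leq_trans (fcap l); apply/subset_leq_card/subsetP => x.
  by rewrite !inE; case: ifP.
- rewrite (_ : [set _ | _] = v |: D); last by apply/setP => x; rewrite !inE; case: ifP.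
  by rewrite cardsU1 vD D_card; lia.
set f' := fun x => _.
have new_pairs : [set (v, y) | y in D] :|: [set (y, v) | y in D]
                   \subset mono_pairs e f'.
  apply/subsetP => p; rewrite !inE => /orP[] /imsetP[y yD ->] /=;
  have [_ evy] := D_free y yD; rewrite /f' !in_setU1 eqxx yD orbT /=.
    by rewrite evy.
  by rewrite esym evy.
(* An edge avoiding [v] has an end in [S :\ v]; if it is monochromatic, both its ends are dirty and
   keep their labels. *)
have old_pairs : mono_pairs (delete e [set v]) f \subset mono_pairs e f'.
  apply/subsetP => -[x y]; rewrite !inE /= /delete !inE.
  move=> /andP[/and3P[exy nxv nyv] /eqP fxy]; rewrite exy /=.
  have [xd yd] : x \in dirty /\ y \in dirty.
    case/orP: (coverP exy) => zS; split; apply/bigcupP;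
      by [exists x; rewrite !inE ?nxv // fxy | exists y; rewrite !inE ?nyv // fxy].
  rewrite /f' !in_setU1 (negPf nxv) (negPf nyv) /=.
  have -> : x \in D = false by apply/negP => /D_free[]; rewrite xd.
  have -> : y \in D = false by apply/negP => /D_free[]; rewrite yd.
  by rewrite fxy.
have disj1 : [disjoint [set (v, y) | y in D] & [set (y, v) | y in D]].
  apply/pred0P => p /=; apply/negP => /andP[/imsetP[y yD ->] /imsetP[z zD [E _]]].
  by rewrite E zD in vD.
have disj2 : [disjoint mono_pairs (delete e [set v]) f
                & [set (v, y) | y in D] :|: [set (y, v) | y in D]].
  apply/pred0P => p /=; apply/negP; rewrite !inE /delete !inE.
  by case/andP => /andP[/and3P[_ n1 n2] _] /orP[] /imsetP[y yD E];
     rewrite E ?eqxx in n1 n2.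
have /subset_leq_card := introT subUsetP (conj old_pairs new_pairs).
rewrite !cardsU (disjoint_setI0 disj1) (disjoint_setI0 disj2) !cards0.
have -> : #|[set (v, y) | y in D]| = #|D| by apply: card_imset => ? ? [].
have -> : #|[set (y, v) | y in D]| = #|D| by apply: card_imset => ? ? [].
by rewrite D_card => H; apply: leq_trans H; lia.
Qed.

End HighDegree.

(* The hypothesis on cap also allows cap = 0 on the empty graph. *)
Lemma achievable_embed (U T : finType) (h : U -> T) (e : rel T) (cap t : nat) :
    symmetric e -> irreflexive e -> injective h -> (T -> 0 < cap) ->
    (forall x y, e x y -> x \in codom h) ->
  achievable (fun a b => e (h a) (h b)) cap t <-> achievable e cap t.
Proof.
move=> esym eirr hinj cap_gt0 hcod.
have usym : symmetric (fun a b => e (h a) (h b)) by move=> a b; apply: esym.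
have uirr : irreflexive (fun a b => e (h a) (h b)) by move=> a; apply: eirr.
have hh_inj : injective (fun p : U * U => (h p.1, h p.2)).
  by move=> [a b] [c d] /= [/hinj-> /hinj->].
rewrite !achievableP //; split=> -[L [f [fcap tf]]].
  (* Vertices outside the image of [h] are isolated and become singleton classes, each labelled by
     itself. *)
  pose g x := if [pick a | h a == x] is Some a then inl (f a) else inr x : L + T.
  have gh a : g (h a) = inl (f a).
    by rewrite /g; case: pickP => [b /eqP/hinj -> //|/(_ a)]; rewrite eqxx.
  exists (L + T)%type, g; split=> [[l|x]|].
  - apply: leq_trans (fcap l); rewrite -(card_imset _ hinj).
    apply/subset_leq_card/subsetP => x; rewrite inE /g.
    case: pickP => [a /eqP <- /eqP[fa]|//]; apply/imsetP; exists a => //.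
    by rewrite inE fa.
  - apply: leq_trans (cap_gt0 x); rewrite -(cards1 x).
    apply/subset_leq_card/subsetP => y; rewrite !inE /g.
    by case: pickP => // _ /eqP[->].
  apply: leq_trans tf _; rewrite -(card_imset _ hh_inj).
  apply/subset_leq_card/subsetP => _ /imsetP[[a b] + ->].
  by rewrite !inE /= !gh => /andP[-> /eqP->] /=.
exists L, (f \o h); split=> [l|].
  apply: leq_trans (fcap l); rewrite -(card_imset _ hinj).
  by apply/subset_leq_card/subsetP => _ /imsetP[a + ->]; rewrite !inE.
apply: leq_trans tf _; rewrite -(card_imset _ hh_inj).
apply/subset_leq_card/subsetP => -[x y]; rewrite !inE /= => /andP[exy fxy].
have /codomP[a xa] := hcod _ _ exy.
have /codomP[b yb] : y \in codom h by apply: (hcod y x); rewrite esym.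
by apply/imsetP; exists (a, b); rewrite ?inE /= -?xa -?yb ?exy.
Qed.

(** A vertex that is not isolated lies in the cover or is a neighbour of a cover vertex. *)
Lemma card_non_isolated (T : finType) (e : rel T) (S : {set T}) (d : nat) :
    symmetric e -> vertex_cover e S ->
    (forall x, #|[set y | e x y]| <= d) ->
  #|[set x | [exists y, e x y]]| <= #|S| * d.+1.
Proof.
move=> esym Scover ed.
apply: leq_trans (_ : #|S :|: \bigcup_(x in S) [set y | e x y]| <= _).
  apply/subset_leq_card/subsetP => x; rewrite inE => /existsP[y exy].
  have /forallP/(_ x)/forallP/(_ y)/implyP/(_ exy)/orP[xS|yS] := Scover.
    by rewrite inE xS.
  by rewrite inE; apply/orP; right; apply/bigcupP; exists y; rewrite // inE esym.
apply: leq_trans (leq_card_setU _ _) _; rewrite mulnS leq_add2l.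
rewrite -sum_nat_const; apply: leq_trans (_ : \sum_(x in S)
  #|[set y | e x y]| <= _); last by apply: leq_sum => x _; apply: ed.
by elim/big_rec2: _ => [|x A n _ IH]; rewrite ?cards0 //;
   apply: leq_trans (leq_card_setU _ _) _; rewrite leq_add2l.
Qed.

(** * Bit lengths *)

Lemma ltn_bitlen k : k < 2 ^ bitlen k.
Proof. exact: trunc_log_ltn. Qed.

Lemma bitlen_leq k b : 0 < b -> k < 2 ^ b -> bitlen k <= b.
Proof.
move=> b0 kb; rewrite /bitlen; case: (posnP k) => [->|k0]; first by rewrite trunc_log0.
by rewrite -(ltn_exp2l _ _ (isT : 1 < 2)); apply: leq_ltn_trans (trunc_logP _ k0) kb.
Qed.

Lemma bitlen_mono k l : k <= l -> bitlen k <= bitlen l.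
Proof. by move=> kl; apply: bitlen_leq => //; apply: leq_ltn_trans kl (ltn_bitlen l). Qed.

Lemma bitlenM k l : bitlen (k * l) <= bitlen k + bitlen l.
Proof.
apply: bitlen_leq => //; rewrite expnD.
have := ltn_bitlen k; have := ltn_bitlen l; set a := 2 ^ _; set b := 2 ^ _.
by move=> la kb; rewrite mulnC; nia.
Qed.

(** * Programs with a uniform bound on values and loop lengths *)

(** If all registers are at most some positive [M], the value of the expression is at most this
    factor times [M]. *)
Fixpoint growth (a : expr) : nat :=
  match a with
  | Const k => k.+1
  | Reg _ => 1
  | Add a1 a2 => growth a1 + growth a2
  | Defs.Sub a1 _ => growth a1
  end.

(** In units of [bitlen M]: a value at most [growth a * M] has at most
    [bitlen (growth a) + bitlen M] bits, and this sum is at most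
    [(bitlen (growth a)).+1 * bitlen M]. *)
Fixpoint expr_weight (a : expr) : nat :=
  match a with
  | Const _ | Reg _ => (bitlen (growth a)).+1
  | Add a1 a2 | Defs.Sub a1 a2 => expr_weight a1 + expr_weight a2 + (bitlen (growth a)).+1
  end.

(* Time of a program all of whose loops make at most N iterations, in units  *)
(* of the bit length of the largest stored value.                            *)
Fixpoint time_bound (N : nat) (c : cmd) : nat :=
  match c with
  | Skip => 1
  | Assign _ a => expr_weight a
  | Read _ a => (expr_weight a).+1
  | Write a1 a2 => expr_weight a1 + expr_weight a2
  | Seq c1 c2 => time_bound N c1 + time_bound N c2
  | If a c1 c2 => expr_weight a + time_bound N c1 + time_bound N c2
  | While a c => N.+1 * (expr_weight a + time_bound N c)
  end.

(** Each loop raises the degree by one. Sequencing and branching simply add the degrees, which is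
    coarse but harmless for a fixed program. *)
Lemma time_bound_poly (c : cmd) :
  exists K d, forall N, time_bound N c <= K * N.+1 ^ d.
Proof.
elim: c => [|x a|x a|a1 a2|c1 [K1 [d1 IH1]] c2 [K2 [d2 IH2]]
           |a c1 [K1 [d1 IH1]] c2 [K2 [d2 IH2]]|a c [K [d IH]]] /=.
- by exists 1, 0.
- by exists (expr_weight a), 0 => N; rewrite muln1.
- by exists (expr_weight a).+1, 0 => N; rewrite muln1.
- by exists (expr_weight a1 + expr_weight a2), 0 => N; rewrite muln1.
- exists (K1 + K2), (d1 + d2) => N; have := IH1 N; have := IH2 N.
  rewrite expnD; have : 0 < N.+1 ^ d1 by rewrite expn_gt0.
  have : 0 < N.+1 ^ d2 by rewrite expn_gt0.
  set u := _ ^ d1; set v := _ ^ d2; nia.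
- exists (expr_weight a + K1 + K2), (d1 + d2) => N; have := IH1 N; have := IH2 N.
  rewrite expnD; have : 0 < N.+1 ^ d1 by rewrite expn_gt0.
  have : 0 < N.+1 ^ d2 by rewrite expn_gt0.
  set u := _ ^ d1; set v := _ ^ d2 => v0 u0 H2 H1.
  have : K1 * u <= K1 * (u * v) by rewrite leq_mul2l leq_pmulr ?orbT.
  have : K2 * v <= K2 * (u * v) by rewrite leq_mul2l leq_pmull ?orbT.
  have : expr_weight a <= expr_weight a * (u * v) by rewrite leq_pmulr ?muln_gt0 ?u0.
  rewrite !mulnDl; lia.
- exists (expr_weight a + K), d.+1 => N; have := IH N.
  rewrite expnS; have : 0 < N.+1 ^ d by rewrite expn_gt0.
  set u := _ ^ d => u0 H; rewrite [leqRHS]mulnCA leq_mul2l /=.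
  have : expr_weight a <= expr_weight a * u by rewrite leq_pmulr.
  rewrite mulnDl; lia.
Qed.

Definition For (x b : nat) (c : cmd) : cmd :=
  Seq (Assign x (Const 0))
      (While (Defs.Sub (Reg b) (Reg x)) (Seq c (Assign x (Add (Reg x) (Const 1))))).

Section BoundedRuns.

Variables M N : nat.

Definition bounded (s : state) : Prop :=
  [/\ 0 < M, forall x, regs s x <= M & forall p, memory s p <= M].

(** Total correctness, running time and boundedness in one predicate. Boundedness of the initial
    state is a premise inside it, so the rules below pass it along silently. *)
Definition wp (c : cmd) (s : state) (Q : state -> Prop) : Prop :=
  bounded s -> exists t s',
    [/\ exec c s t s', t <= time_bound N c * bitlen M, bounded s' & Q s'].

Lemma eval_growth s a : bounded s -> eval s a <= growth a * M.
Proof.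
move=> [M0 rM _]; elim: a => [k|x|a1 IH1 a2 IH2|a1 IH1 a2 IH2] /=.
- by nia.
- by rewrite mul1n.
- by rewrite mulnDl leq_add.
- by apply: leq_trans IH1; rewrite leq_subr.
Qed.

Lemma cost_weight s a : bounded s -> cost s a <= expr_weight a * bitlen M.
Proof.
move=> sM.
have H b : bitlen (eval s b) <= (bitlen (growth b)).+1 * bitlen M.
  apply: leq_trans (bitlen_mono (eval_growth b sM)) _.
  apply: leq_trans (bitlenM _ _) _; rewrite mulSn addnC leq_add2l.
  by rewrite leq_pmulr.
by elim: a => [k|x|a1 IH1 a2 IH2|a1 IH1 a2 IH2] /=; rewrite ?mulnDl ?leq_add //;
  [exact: (H (Const k)) | exact: (H (Reg x)) | exact: (H (Add a1 a2))
  | exact: (H (Defs.Sub a1 a2))].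
Qed.

Lemma bounded_set_reg s x v : bounded s -> v <= M -> bounded (set_reg s x v).
Proof. by move=> [M0 rM mM] vM; split=> // y /=; rewrite /update; case: ifP. Qed.

Lemma bounded_set_mem s p v : bounded s -> v <= M -> bounded (set_mem s p v).
Proof. by move=> [M0 rM mM] vM; split=> // y /=; rewrite /update; case: ifP. Qed.

Lemma wp_skip s (Q : state -> Prop) : Q s -> wp Skip s Q.
Proof. by move=> Qs sM; exists 1, s; split=> //; constructor. Qed.

Lemma wp_assign s x a (Q : state -> Prop) :
  eval s a <= M -> Q (set_reg s x (eval s a)) -> wp (Assign x a) s Q.
Proof.
move=> aM Qs sM; exists (cost s a), (set_reg s x (eval s a)).
by split=> //; [constructor | exact: cost_weight | exact: bounded_set_reg].
Qed.

Lemma wp_read s x a (Q : state -> Prop) :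
  Q (set_reg s x (memory s (eval s a))) -> wp (Read x a) s Q.
Proof.
move=> Qs sM; do 2!eexists; split; [constructor | | | exact: Qs].
  rewrite /= mulSn addnC leq_add ?cost_weight //.
  by apply: bitlen_mono; case: sM.
by apply: bounded_set_reg => //; case: sM.
Qed.

Lemma wp_write s a1 a2 (Q : state -> Prop) :
  eval s a2 <= M -> Q (set_mem s (eval s a1) (eval s a2)) -> wp (Write a1 a2) s Q.
Proof.
move=> aM Qs sM; do 2!eexists; split; [constructor | | | exact: Qs].
  by rewrite /= mulnDl leq_add ?cost_weight.
exact: bounded_set_mem.
Qed.

Lemma wp_seq c1 c2 s Q : wp c1 s (fun s' => wp c2 s' Q) -> wp (Seq c1 c2) s Q.
Proof.
move=> H sM; have [t1 [s1 [e1 T1 s1M H2]]] := H sM.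
have [t2 [s2 [e2 T2 s2M Q2]]] := H2 s1M.
exists (t1 + t2), s2; split=> //; first exact: ExecSeq e1 e2.
by rewrite /= mulnDl leq_add.
Qed.

Lemma wp_if a c1 c2 s Q :
  (eval s a <> 0 -> wp c1 s Q) -> (eval s a = 0 -> wp c2 s Q) ->
  wp (If a c1 c2) s Q.
Proof.
move=> H1 H2 sM; have aM := cost_weight a sM.
case: (eqVneq (eval s a) 0) => [a0 | /eqP a0].
  have [t [s' [e T s'M Qs']]] := H2 a0 sM.
  exists (cost s a + t), s'; split=> //; first exact: ExecIfFalse.
  by rewrite /= !mulnDl; lia.
have [t [s' [e T s'M Qs']]] := H1 a0 sM.
exists (cost s a + t), s'; split=> //; first exact: ExecIfTrue.
by rewrite /= !mulnDl; lia.
Qed.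

Lemma wp_conseq c s (Q Q' : state -> Prop) :
  wp c s Q -> (forall s', Q s' -> Q' s') -> wp c s Q'.
Proof.
by move=> H QQ sM; have [t [s' [? ? ? /QQ ?]]] := H sM; exists t, s'.
Qed.

(** [k <= N] pays for the iterations, [k <= M] keeps the index bounded. The invariant is required
    after the increment of the index, which the body itself must preserve. *)
Lemma wp_for (x b : nat) c k s (Inv : nat -> state -> Prop) (Q : state -> Prop) :
    x != b -> k <= N -> k <= M -> regs s b = k ->
    Inv 0 (set_reg s x 0) ->
    (forall i s', i < k -> regs s' x = i -> regs s' b = k -> Inv i s' ->
       wp c s' (fun s'' => [/\ regs s'' x = i, regs s'' b = k
                             & Inv i.+1 (set_reg s'' x i.+1)])) ->
    (forall s', regs s' x = k -> regs s' b = k -> Inv k s' -> Q s') ->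
  wp (For x b c) s Q.
Proof.
move=> xb kN kM sb Inv0 step fin; apply: wp_seq; apply: wp_assign => //=.
set s0 := set_reg s x 0.
have s0x : regs s0 x = 0 by rewrite /= /update eqxx.
have s0b : regs s0 b = k by rewrite /= /update eq_sym (negPf xb).
set body := Seq c _; set test := Defs.Sub _ _.
(* Induction on the number [n] of iterations left; [n.+1] includes the final failing test. *)
suff H n i s1 : i + n = k -> regs s1 x = i -> regs s1 b = k -> Inv i s1 ->
    bounded s1 -> exists t s', [/\ exec (While test body) s1 t s',
      t <= n.+1 * ((expr_weight test + time_bound N body) * bitlen M),
      bounded s' & Q s'].
  move=> s0M; have [t [s' [e T s'M Qs']]] := H k 0 s0 (add0n k) s0x s0b Inv0 s0M.
  exists t, s'; split=> //; apply: leq_trans T _.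
  by rewrite /= -mulnA leq_mul2r ltnS kN orbT.
elim: n i s1 => [|n IH] i s1 ik sx sb1 I1 s1M.
  have ik' : i = k by lia.
  exists (cost s1 test), s1; split=> //.
  - by apply: ExecWhileDone; rewrite /= sx sb1; lia.
  - by rewrite mul1n mulnDl; have := cost_weight test s1M; lia.
  - by apply: fin; rewrite // -?ik'.
have wbody : wp body s1 (fun s'' => [/\ regs s'' x = i.+1, regs s'' b = k & Inv i.+1 s'']).
  apply: wp_seq; apply: wp_conseq (step i s1 _ sx sb1 I1) _; first lia.
  move=> s2 [s2x s2b I2]; apply: wp_assign => /=; rewrite s2x addn1; first lia.
  by rewrite /update eqxx eq_sym (negPf xb).
have [t1 [s2 [e1 T1 s2M [s2x s2b I2]]]] := wbody s1M.
have [|t2 [s3 [e2 T2 s3M Q3]]] := IH i.+1 s2 _ s2x s2b I2 s2M; first lia.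
exists (cost s1 test + t1 + t2), s3; split=> //.
  by apply: ExecWhileStep e1 e2; rewrite /= sx sb1; lia.
rewrite mulSn mulnDl; have := cost_weight test s1M; move: T2.
by rewrite mulnDl; lia.
Qed.

End BoundedRuns.

(** * The kernelization program *)

(* Registers: 0, 1, 2 hold n, cap, t; 3 holds n^2; 4 the degree threshold;    *)
(* 5, 6 loop indices; 7 a matrix address; 11 the number of kept vertices.     *)
(* Behind the matrix, memory holds four arrays of length n: the marks of the  *)
(* matched vertices, the marks of the deleted ones, the kept vertices and     *)
(* the addresses of their rows.                                               *)
Definition matched_at (r : nat) : expr := Add (Reg 3) (Reg r).
Definition deleted_at (r : nat) : expr := Add (Add (Reg 3) (Reg 0)) (Reg r).
Definition kept_at (r : nat) : expr :=
  Add (Add (Add (Reg 3) (Reg 0)) (Reg 0)) (Reg r).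
Definition kept_row_at (r : nat) : expr :=
  Add (Add (Add (Add (Reg 3) (Reg 0)) (Reg 0)) (Reg 0)) (Reg r).

Definition incr (r : nat) : cmd := Assign r (Add (Reg r) (Const 1)).

(** The machine has no multiplication, so the square is a repeated sum. *)
Definition square : cmd :=
  Seq (Assign 3 (Const 0)) (For 5 0 (Assign 3 (Add (Reg 3) (Reg 0)))).

(** Greedy maximal matching. The test is nonzero exactly for an edge with both ends unmarked,
    register 7 follows the scan through the matrix, and register 4 grows by the capacity per matched
    vertex, so it ends as the degree threshold. *)
Definition matching : cmd :=
  Seq (Assign 4 (Const 0)) (Seq (Assign 7 (Const 0))
  (For 5 0 (For 6 0
    (Seq (Read 8 (Reg 7)) (Seq (Read 9 (matched_at 5)) (Seq (Read 10 (matched_at 6))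
    (Seq (If (Defs.Sub (Reg 8) (Add (Reg 9) (Reg 10)))
            (Seq (Write (matched_at 5) (Const 1))
            (Seq (Write (matched_at 6) (Const 1))
                 (Assign 4 (Add (Add (Reg 4) (Reg 1)) (Reg 1)))))
            Skip)
         (incr 7)))))))).

(** Works on the row starting at the address in register 7 and leaves there the start of the next
    row. *)
Definition degree : cmd :=
  Seq (Assign 10 (Const 0))
  (For 6 0
    (Seq (Read 8 (Reg 7)) (Seq (Read 9 (deleted_at 6))
    (Seq (If (Defs.Sub (Reg 8) (Reg 9)) (incr 10) Skip)
         (incr 7))))).

Definition prune : cmd :=
  Seq (Assign 7 (Const 0))
  (For 5 0
    (Seq degree
         (If (Defs.Sub (Reg 10) (Reg 4))
            (Seq (Write (deleted_at 5) (Const 1))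
                 (Assign 2 (Defs.Sub (Reg 2) (Defs.Sub (Reg 1) (Const 1)))))
            Skip))).

(** Register 7 has already passed the current row, hence the subtraction in the stored row
    address. *)
Definition collect : cmd :=
  Seq (Assign 7 (Const 0)) (Seq (Assign 11 (Const 0))
  (For 5 0
    (Seq degree (Seq (Read 8 (deleted_at 5))
         (If (Reg 8) Skip
           (If (Reg 10)
              (Seq (Write (kept_at 11) (Reg 5))
              (Seq (Write (kept_row_at 11) (Defs.Sub (Reg 7) (Reg 0)))
                   (incr 11)))
              Skip)))))).

Definition emit : cmd :=
  Seq (Assign 7 (Const 0))
  (For 5 11
    (Seq (Read 12 (kept_row_at 5))
    (For 6 11
      (Seq (Read 13 (kept_at 6)) (Seq (Read 8 (Add (Reg 12) (Reg 13)))
      (Seq (Write (Reg 7) (Reg 8)) (incr 7))))))).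

(** Register 7 still holds the square of the number of kept vertices. *)
Definition finish : cmd :=
  Seq (If (Defs.Sub (Reg 2) (Reg 7)) (Assign 2 (Add (Reg 7) (Const 1))) Skip)
      (Assign 0 (Reg 11)).

Definition reduce : cmd :=
  Seq square (Seq matching (Seq prune (Seq collect (Seq emit finish)))).

Lemma updateE f x v y : update f x v y = if y == x then v else f y.
Proof. by []. Qed.

Lemma card_ltnS n (P : pred 'I_n) (b : 'I_n) :
  #|[set y : 'I_n | (y < b.+1) && P y]| = #|[set y : 'I_n | (y < b) && P y]| + P b.
Proof.
rewrite (cardsD1 b) !inE ltnSn /= addnC; congr (_ + _).
apply: eq_card => y; rewrite !inE ltnS leq_eqVlt -[_ == b :> nat]/(y == b).
by case: eqVneq => // ->; rewrite ltnn.
Qed.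

Lemma adj_cellE (I : instance) (i j : 'I_(nvert I)) :
  adj_cell I (i * nvert I + j) = adj i j.
Proof.
rewrite /adj_cell; congr nat_of_bool; apply/existsP/idP => [[x /existsP[y /andP[/eqP E xy]]]|ij].
  have yI := ltn_ord y; have jI := ltn_ord j.
  suff [-> ->] : i = x /\ j = y by [].
  have Ex : i = x.
    apply/val_inj => /=; have := f_equal (divn^~ (nvert I)) E.
    by rewrite !divnMDl ?divn_small ?addn0 //; lia.
  by split=> //; apply/val_inj => /=; move: E; rewrite Ex; lia.
by exists i; apply/existsP; exists j; rewrite eqxx.
Qed.

Lemma adj_cell_out (I : instance) p : nvert I * nvert I <= p -> adj_cell I p = 0.
Proof.
move=> np; rewrite /adj_cell; case: existsP => // -[x /existsP[y /andP[/eqP E _]]].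
by have := ltn_ord x; have := ltn_ord y; nia.
Qed.

(** * Correctness of the phases of the program *)

Section Correctness.

Variables (I : instance) (M N : nat).

Let n := nvert I.
Let e : rel 'I_n := @adj I.
Let cap := capacity I.

Hypothesis n_le_N : n <= N.
Hypothesis M_large : n * n + 4 * n + n * cap + cap + target I + 2 <= M.
(* Holds unless cap = 0 < n, a case treated before this program is run. *)
Hypothesis cap_gt0 : 'I_n -> 0 < cap.

Let esym : symmetric e := @adj_sym I.
Let eirr : irreflexive e := @adj_irr I.

Let M_gt0 : 0 < M. Proof. lia. Qed.
Let n_le_M : n <= M. Proof. nia. Qed.

Record layout (s : state) (X D : {set 'I_n}) : Prop := Layout {
  layout_n : regs s 0 = n;
  layout_cap : regs s 1 = cap;
  layout_sqr : regs s 3 = n * n;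
  layout_adj : forall i j : 'I_n, memory s (i * n + j) = e i j;
  layout_matched : forall i : 'I_n, memory s (n * n + i) = (i \in X);
  layout_deleted : forall i : 'I_n, memory s (n * n + n + i) = (i \in D)
}.

Lemma layout_eq s s' X D :
    layout s X D -> memory s' = memory s -> regs s' 0 = regs s 0 ->
    regs s' 1 = regs s 1 -> regs s' 3 = regs s 3 ->
  layout s' X D.
Proof. by case=> *; split; congruence. Qed.

Lemma cell_ltn (i j : 'I_n) : i * n + j < n * n.
Proof. have := ltn_ord i; have := ltn_ord j; nia. Qed.

Lemma layout_match s X D (a : 'I_n) :
  layout s X D -> layout (set_mem s (n * n + a) 1) (a |: X) D.
Proof.
case=> r0 r1 r3 A mX mD; split=> //= i; rewrite ?updateE.
- by move=> j; rewrite updateE ifF ?A //; have := cell_ltn i j; lia.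
- by rewrite eqn_add2l -[_ == a :> nat]/(i == a) in_setU1; case: eqP.
- by rewrite ifF ?mD //; have := ltn_ord a; lia.
Qed.

Lemma layout_delete s X D (a : 'I_n) :
  layout s X D -> layout (set_mem s (n * n + n + a) 1) X (a |: D).
Proof.
case=> r0 r1 r3 A mX mD; split=> //= i; rewrite ?updateE.
- by move=> j; rewrite updateE ifF ?A //; have := cell_ltn i j; lia.
- by rewrite ifF ?mX //; have := ltn_ord i; lia.
- by rewrite eqn_add2l -[_ == a :> nat]/(i == a) in_setU1; case: eqP.
Qed.

Lemma layout_high s X D p v :
  n * n + n + n <= p -> layout s X D -> layout (set_mem s p v) X D.
Proof.
move=> pn [r0 r1 r3 A mX mD]; split=> //= i; rewrite ?updateE.
- by move=> j; rewrite updateE ifF ?A //; have := cell_ltn i j; lia.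
- by rewrite ifF ?mX //; have := ltn_ord i; lia.
- by rewrite ifF ?mD //; have := ltn_ord i; lia.
Qed.

Lemma wp_square s :
    regs s 0 = n ->
  wp M N square s (fun s' => [/\ memory s' = memory s, regs s' 3 = n * n
    & forall x, x \notin [:: 3; 5] -> regs s' x = regs s x]).
Proof.
move=> r0; apply: wp_seq; apply: wp_assign => //=.
apply: (wp_for (k := n) (Inv := fun i s' => [/\ memory s' = memory s,
  regs s' 3 = i * n & forall x, x \notin [:: 3; 5] -> regs s' x = regs s x])) => //=.
- split=> // x; rewrite /update !inE => /norP[/negPf-> /negPf->]; done.
- move=> i s' i_lt s'5 s'0 [m r3 fr]; apply: wp_assign => //=; rewrite r3 s'0; first nia.
  rewrite /update /=; split=> //; split=> //; first lia.
  by move=> x xn; have := fr x xn; move: xn; rewrite !inE => /norP[/negPf-> /negPf->].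
Qed.

(** [X] consists of the ends of a maximal matching. Each matched edge adds two vertices to [X], at
    least one of them in any given cover [S]; this maintains the invariant
    [#|X| <= 2 * #|X :&: S|]. *)
Lemma wp_matching s :
    layout s set0 set0 ->
  wp M N matching s (fun s' => exists X,
    [/\ layout s' X set0, regs s' 2 = regs s 2, regs s' 4 = #|X| * cap,
        vertex_cover e X & forall S : {set 'I_n}, vertex_cover e S -> #|X| <= 2 * #|S|]).
Proof.
move=> L0; apply: wp_seq; apply: wp_assign => //=.
apply: wp_seq; apply: wp_assign => //=.
(* The pairs scanned so far are those whose matrix cell lies before address [i * n + j]. *)
pose inv i j s' := exists X : {set 'I_n},
  [/\ layout s' X set0, regs s' 2 = regs s 2, regs s' 4 = #|X| * cap
    & [/\ regs s' 7 = i * n + j,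
          forall a b : 'I_n, a * n + b < i * n + j -> e a b -> (a \in X) || (b \in X)
        & forall S : {set 'I_n}, vertex_cover e S -> #|X| <= 2 * #|X :&: S|]].
have r0 := layout_n L0.
apply: (wp_for (k := n) (Inv := fun i => inv i 0)) => //=.
- by exists set0; split=> //=; [exact: layout_eq L0 _ _ _ _ | rewrite cards0
    | split=> // S _; rewrite cards0].
- move=> i s1 i_lt s1i s1n inv1.
  apply: (wp_for (k := n) (Inv := fun j s' => regs s' 5 = i /\ inv i j s')) => //=.
  + split=> //; have [X [L r2 r4 r7]] := inv1; exists X; split=> //=.
    exact: layout_eq L _ _ _ _.
  + move=> j s2 j_lt s2j s2n [s2i [X [L r2 r4 [r7 cov bnd]]]].
    pose a := Ordinal i_lt; pose b := Ordinal j_lt.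
    have [_ r1 r3 A mX mD] := L.
    do 3!(apply: wp_seq; apply: wp_read => /=; rewrite /update /=).
    rewrite r3 r7 s2i s2j (A a b) (mX a) (mX b).
    apply: wp_seq; apply: wp_if => /=; rewrite /update /= => t.
    * have [eab aX bX] : [/\ e a b, a \notin X & b \notin X].
        by move: t; case: (e a b) (a \in X) (b \in X) => [] [] [].
      have ab : a != b by apply: contraTneq eab => ->; rewrite eirr.
      have cardX' : #|a |: (b |: X)| = #|X|.+2.
        by rewrite !cardsU1 in_setU1 (negPf ab) aX bX.
      have X'n : #|X|.+2 <= n by rewrite -cardX' -[n in _ <= n]card_ord max_card.
      do 2!(apply: wp_seq; apply: wp_write; [exact: M_gt0 | rewrite /= /update /=]).
      rewrite r3 s2i s2j.
      apply: wp_assign; rewrite /= /update /= r4 r1; first nia.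
      apply: wp_assign; rewrite /= /update /= r7; first by have /= := cell_ltn a b; lia.
      split=> //; split=> //; exists (a |: (b |: X)); split=> //=.
      -- rewrite setUCA.
         exact: layout_eq (layout_match b (layout_match a L)) _ _ _ _.
      -- by rewrite /update /= cardX' !mulSn addnC [_ + cap]addnC.
      split=> //=; rewrite /update /= ?addn1 ?addnS //.
      -- move=> x y xy exy.
         case: (ltnP (x * n + y) (i * n + j)) => [lt|ge].
           by have := cov x y lt exy; rewrite !inE => /orP[] ->; rewrite ?orbT.
         have E : x * n + y = i * n + j by lia.
         have := ltn_ord y => y_lt.
         have Ex : x = a.
           apply/val_inj => /=.
           have := f_equal (divn^~ n) E.
           by rewrite !divnMDl ?divn_small ?addn0 //; lia.
         by rewrite Ex !inE eqxx.
      (* Both ends of the new edge are outside [X], and [S] contains one of them. *)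
      -- move=> S cS; rewrite cardX'.
         have := forallP (forallP cS a) b; rewrite eab /= => ab_S.
         suff XS : #|X :&: S| < #|(a |: (b |: X)) :&: S|.
           apply: leq_trans (_ : 2 * #|X :&: S|.+1 <= _); last by rewrite leq_mul2l.
           by rewrite mulnS add2n !ltnS bnd.
         case/orP: ab_S => zS.
           have := cardsD1 a ((a |: (b |: X)) :&: S); rewrite !inE eqxx zS /= => ->.
           rewrite add1n ltnS; apply/subset_leq_card/subsetP => x; rewrite !inE.
           case/andP=> xX ->; rewrite xX !orbT !andbT.
           by apply: contraNneq aX => <-.
         have := cardsD1 b ((a |: (b |: X)) :&: S); rewrite !inE eqxx zS orbT /= => ->.
         rewrite add1n ltnS; apply/subset_leq_card/subsetP => x; rewrite !inE.
         case/andP=> xX ->; rewrite xX !orbT !andbT.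
         by apply: contraNneq bX => <-.
    * apply: wp_skip; apply: wp_assign; rewrite /= /update /= r7.
        by have /= := cell_ltn a b; lia.
      split=> //; split=> //; exists X; split=> //=.
      split=> //=; rewrite /update /= ?addn1 ?addnS //.
      move=> x y xy exy.
      case: (ltnP (x * n + y) (i * n + j)) => [lt|ge]; first exact: cov.
      have E : x * n + y = i * n + j by lia.
      have := ltn_ord y => y_lt.
      have Ex : x = a.
        apply/val_inj => /=; have := f_equal (divn^~ n) E.
        by rewrite !divnMDl ?divn_small ?addn0 //; lia.
      have Ey : y = b by apply/val_inj => /=; move: E; rewrite Ex /=; lia.
      by move: t exy; rewrite Ex Ey; case: (e a b) (a \in X) (b \in X) => [] [] [].
  + move=> s2 s2j s2n [s2i [X [L r2 r4 [r7 cov bnd]]]]; split=> //.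
    exists X; split=> //=; first exact: layout_eq L _ _ _ _.
    split=> //=; first by rewrite /update /= r7; lia.
    by move=> a b ab; apply: cov; lia.
- move=> s' _ _ [X [L r2 r4 [r7 cov bnd]]]; exists X; split=> //.
    apply/forallP => x; apply/forallP => y; apply/implyP; apply: cov.
    by rewrite addn0 cell_ltn.
  move=> S /bnd XS; apply: leq_trans XS _.
  by rewrite leq_mul2l subset_leq_card ?subsetIr.
Qed.


(** Whether [v] itself is deleted is not tested, so the count is meant as the degree in [delete e D]
    only for [v \notin D]. *)
Lemma wp_degree s X D (v : 'I_n) :
    layout s X D -> regs s 7 = v * n ->
  wp M N degree s (fun s' => [/\ memory s' = memory s,
    forall x, x \notin [:: 6; 7; 8; 9; 10] -> regs s' x = regs s x,
    regs s' 10 = #|[set y | e v y && (y \notin D)]| & regs s' 7 = v.+1 * n]).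
Proof.
move=> L r7; have [r0 r1 r3 A _ mD] := L.
apply: wp_seq; apply: wp_assign => //=.
apply: (wp_for (k := n) (Inv := fun j s' => [/\ memory s' = memory s,
    forall x, x \notin [:: 6; 7; 8; 9; 10] -> regs s' x = regs s x,
    regs s' 10 = #|[set y : 'I_n | (y < j) && (e v y && (y \notin D))]|
    & regs s' 7 = v * n + j])) => //=.
- split=> //; rewrite /update //=.
  + by move=> x; rewrite !inE !negb_or => /and5P[/negPf-> _ _ _ /negPf->].
  + by rewrite (_ : [set _ | _] = set0) ?cards0 //; apply/setP => y; rewrite !inE.
  + by rewrite addn0.
- move=> j s1 j_lt s1j s1n [m fr r10 r7'].
  pose b := Ordinal j_lt; have /= vb := cell_ltn v b.
  have r3' : regs s1 3 = n * n by rewrite fr.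
  have r0' : regs s1 0 = n by rewrite fr.
  have dn : regs s1 10 <= n by rewrite r10 -[n in _ <= n]card_ord max_card.
  do 2!(apply: wp_seq; apply: wp_read => /=; rewrite /update /=).
  rewrite r7' r3' r0' s1j m (A v b) (mD b).
  have := card_ltnS (fun y => e v y && (y \notin D)) b; rewrite /= -r10 => cS.
  have fin s2 : memory s2 = memory s1 ->
      (forall x, x \notin [:: 6; 7; 8; 9; 10] -> regs s2 x = regs s1 x) ->
      regs s2 6 = j -> regs s2 7 = v * n + j ->
      regs s2 10 = regs s1 10 + (e v b && (b \notin D)) ->
    wp M N (incr 7) s2 (fun s'' => [/\ regs s'' 6 = j, regs s'' 0 = n &
      [/\ memory (set_reg s'' 6 j.+1) = memory s,
        forall x, x \notin [:: 6; 7; 8; 9; 10] ->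
          regs (set_reg s'' 6 j.+1) x = regs s x,
        regs (set_reg s'' 6 j.+1) 10 =
          #|[set y : 'I_n | (y < j.+1) && (e v y && (y \notin D))]|
        & regs (set_reg s'' 6 j.+1) 7 = v * n + j.+1]]).
    move=> m2 fr2 r6_2 r7_2 r10_2.
    apply: wp_assign; rewrite /= /update /= r7_2; first lia.
    rewrite (fr2 0) // r0'; split=> //; split=> //; [by rewrite m2| |by rewrite cS|lia].
    move=> x xn; rewrite -fr // -fr2 //; move: xn.
    by rewrite !inE !negb_or => /and5P[/negPf-> /negPf->].
  apply: wp_seq; apply: wp_if => /=; rewrite /update /= => t.
  + apply: wp_assign; rewrite /= /update /=; first lia.
    apply: fin => //=.
    * by move=> x; rewrite /update !inE !negb_or
        => /and5P[_ _ /negPf-> /negPf-> /negPf->].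
    * by rewrite /update /=; move: t; case: (e v b) (b \in D) => [] [].
  + apply: wp_skip; apply: fin => //=.
    * by move=> x; rewrite /update !inE !negb_or
        => /and5P[_ _ /negPf-> /negPf-> _].
    * by rewrite /update /=; move: t; case: (e v b) (b \in D) => [] [] //; rewrite addn0.
- move=> s' _ _ [m fr r10 r7']; split=> //; last by rewrite r7'; lia.
  by rewrite r10; apply: eq_card => y; rewrite !inE ltn_ord.
Qed.

(** A single pass suffices: later deletions only lower degrees, and a deleted vertex has degree
    zero. The set [X] covers every remaining graph, so the threshold can stay fixed. *)
Lemma wp_prune s X :
    layout s X set0 -> vertex_cover e X -> regs s 4 = #|X| * cap ->
    regs s 2 <= target I ->
  wp M N prune s (fun s' => exists D,
    [/\ layout s' X D, forall x, #|[set y | delete e D x y]| <= #|X| * cap,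
        regs s' 2 <= target I
      & achievable (delete e D) cap (regs s' 2) <-> achievable e cap (regs s 2)]).
Proof.
move=> L0 Xcover r4 tI; have r0 := layout_n L0.
apply: wp_seq; apply: wp_assign => //=.
apply: (wp_for (k := n) (Inv := fun i s' => exists D : {set 'I_n},
  [/\ layout s' X D, regs s' 7 = i * n, regs s' 4 = #|X| * cap, regs s' 2 <= target I
    & [/\ forall x, x \in D -> x < i,
          forall x : 'I_n, x < i -> #|[set y | delete e D x y]| <= #|X| * cap
        & achievable (delete e D) cap (regs s' 2) <-> achievable e cap (regs s 2)]])) => //=.
- exists set0; split=> //=; first exact: layout_eq L0 _ _ _ _.
  by split=> // [x|]; rewrite ?inE //; apply: eq_achievable; apply: delete_set0.
- move=> i s1 i_lt s1i s1n [D [L r7 r4' t1 [Di degs ach]]].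
  pose v := Ordinal i_lt.
  apply: wp_seq; apply: wp_conseq (wp_degree L (v := v) r7) _.
  move=> s2 [m fr r10 r7'].
  have r2i : regs s2 5 = i by rewrite fr.
  have L2 : layout s2 X D by apply: layout_eq L _ _ _ _; rewrite ?fr.
  have vD : v \notin D by apply/negP => /Di; rewrite ltnn.
  have degE : #|[set y | e v y && (y \notin D)]| = #|[set y | delete e D v y]|.
    by apply: eq_card => y; rewrite !inE /delete vD.
  rewrite degE in r10.
  have mono (D' : {set 'I_n}) x : D \subset D' ->
      #|[set y | delete e D' x y]| <= #|[set y | delete e D x y]|.
    move=> /subsetP DD'; apply/subset_leq_card/subsetP => y; rewrite !inE.
    by case/and3P=> exy xD yD; apply/and3P; split=> //; [apply: contraNN xD|
      apply: contraNN yD]; apply: DD'.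
  apply: wp_if => /=; rewrite r10 fr // r4' => t.
  + apply: wp_seq; apply: wp_write; first exact: M_gt0.
    rewrite /= (layout_sqr L2) (layout_n L2) r2i.
    have L3 := layout_delete v L2.
    apply: wp_assign; rewrite /= fr // ; first lia.
    split=> //; first exact: layout_n L2.
    exists (v |: D); rewrite /= /update /=; split=> //=.
    * exact: layout_eq L3 _ _ _ _.
    * by rewrite fr.
    * lia.
    split=> // [x|x x_lt|].
    * by rewrite in_setU1 => /orP[/eqP-> //|/Di]; apply: ltnW.
    * case: (eqVneq x v) => [->|xv].
        rewrite (_ : [set _ | _] = set0) ?cards0 //; apply/setP => y.
        by rewrite !inE /delete !inE eqxx /= andbF.
      apply: leq_trans (mono _ x (subsetUr _ _)) (degs _ _).
      by move: x_lt; rewrite ltnS leq_eqVlt => /orP[/eqP xi|//];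
        case/eqP: xv; apply: val_inj.
    * rewrite (layout_cap L2) -ach (eq_achievable _ _ (deleteU1 e v D)).
      symmetry; apply: (achievable_delete_high (S := X)).
      - exact: delete_sym.
      - exact: delete_irr.
      - apply/forallP => x; apply/forallP => y; apply/implyP => /and3P[exy _ _].
        by have /forallP/(_ x)/forallP/(_ y)/implyP := Xcover; apply.
      - exact: cap_gt0 v.
      - by rewrite -subn_gt0 lt0n; apply/eqP.
  + apply: wp_skip; split=> //; first exact: layout_n L2.
    exists D; rewrite /= /update /=; split=> //=; rewrite ?fr //.
    * exact: layout_eq L2 _ _ _ _.
    split=> // x; first by move/Di; apply: ltnW.
    rewrite ltnS leq_eqVlt => /orP[/eqP xi|]; last exact: degs.
    by rewrite (_ : x = v); [rewrite -subn_eq0; apply/eqP | apply: val_inj].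
- move=> s' _ _ [D [L _ _ t1 [_ degs ach]]]; exists D; split=> // x.
  exact: degs.
Qed.

(** Row addresses are tabulated since the machine cannot multiply; the default of [nth] is never
    reached. *)
Definition lists (s : state) (K : seq 'I_n) : Prop :=
  forall a, a < size K ->
    memory s (n * n + n + n + a) = nth 0 (map val K) a /\
    memory s (n * n + n + n + n + a) = nth 0 (map val K) a * n.

(** Vertices are collected in increasing order, so the entry at position [a] is at least [a]; the
    compaction in place relies on this. *)
Lemma wp_collect s X D :
    layout s X D ->
  wp M N collect s (fun s' => exists K,
    [/\ layout s' X D, regs s' 2 = regs s 2, regs s' 11 = size K, lists s' K
      & [/\ uniq K, forall x, x \in K = [exists y, delete e D x y], size K <= n
          & forall a, a < size K -> a <= nth 0 (map val K) a]]).
Proof.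
move=> L0; have r0 := layout_n L0.
do 2!(apply: wp_seq; apply: wp_assign => //=).
apply: (wp_for (k := n) (Inv := fun i s' => exists K,
    [/\ layout s' X D, regs s' 2 = regs s 2, regs s' 11 = size K, lists s' K
      & [/\ regs s' 7 = i * n, uniq K,
            forall x, x \in K = (x < i) && [exists y, delete e D x y], size K <= i
          & forall a, a < size K -> a <= nth 0 (map val K) a]])) => //=.
- by exists [::]; split=> //; exact: layout_eq L0 _ _ _ _.
- move=> i s1 i_lt s1i s1n [K [L r2 r11 lK [r7 uK mK sK gK]]].
  pose v := Ordinal i_lt.
  apply: wp_seq; apply: wp_conseq (wp_degree L (v := v) r7) _.
  move=> s2 [m fr r10 r7'].
  have r2i : regs s2 5 = i by rewrite fr.
  have L2 : layout s2 X D by apply: layout_eq L _ _ _ _; rewrite ?fr.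
  have lK2 : lists s2 K by move=> a /lK; rewrite m.
  have memE b : [exists y, delete e D v y] = b ->
      forall x, x \in (if b then rcons K v else K)
        = (x < i.+1) && [exists y, delete e D x y].
    move=> vb x; rewrite ltnS leq_eqVlt -[_ == i]/(x == v).
    have vK : (v \in K) = false by rewrite mK ltnn.
    case: ifP vb => _ vb; rewrite ?mem_rcons ?in_cons mK.
      by case: eqVneq => [->|_] //=; rewrite vb.
    by case: eqVneq => [->|_] //=; rewrite vb ltnn.
  apply: wp_seq; apply: wp_read.
  rewrite [eval _ _]/= (layout_sqr L2) (layout_n L2) r2i (layout_deleted L2 v).
  (* A vertex is passed over when it is deleted or has no remaining neighbour; in either case it is
     isolated in [delete e D]. *)
  have skip : [exists y, delete e D v y] = false ->
    wp M N Skip (set_reg s2 8 (v \in D)) (fun s'' => [/\ regs s'' 5 = i, regs s'' 0 = n &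
      exists K, [/\ layout (set_reg s'' 5 i.+1) X D, regs (set_reg s'' 5 i.+1) 2 = regs s 2,
        regs (set_reg s'' 5 i.+1) 11 = size K, lists (set_reg s'' 5 i.+1) K
      & [/\ regs (set_reg s'' 5 i.+1) 7 = i.+1 * n, uniq K,
            forall x, x \in K = (x < i.+1) && [exists y, delete e D x y], size K <= i.+1
          & forall a, a < size K -> a <= nth 0 (map val K) a]]]).
    move=> vf; apply: wp_skip; split=> //; first by rewrite /= /update /= (layout_n L2).
    exists K; rewrite /= /update /=; split=> //; rewrite ?(fr 2) ?(fr 11) //.
      exact: layout_eq L2 _ _ _ _.
    by split=> //; [exact: (memE false vf) | apply: leq_trans sK _].
  apply: wp_if => /=; rewrite /update /= => vD.
    apply: skip; apply/existsP => -[y /and3P[_ + _]].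
    by case: (v \in D) vD.
  have {}vD : v \notin D by case: (v \in D) vD.
  apply: wp_if => /=; rewrite /update /= r10 => dv; last first.
    apply: skip; apply/existsP => -[y /and3P[evy _ yD]].
    by move/eqP: dv; rewrite cards_eq0 => /eqP/setP/(_ y); rewrite !inE evy yD.
  have vt : [exists y, delete e D v y] = true.
    move/eqP: dv; rewrite cards_eq0 => /set0Pn[y]; rewrite inE => /andP[evy yD].
    by apply/existsP; exists y; apply/and3P.
  have kn : size K < n by apply: leq_ltn_trans sK i_lt.
  have r11' : regs s2 11 = size K by rewrite fr.
  apply: wp_seq; apply: wp_write; first by rewrite /= /update /= r2i; lia.
  rewrite /= /update /= (layout_sqr L2) (layout_n L2) r11' r2i.
  apply: wp_seq; apply: wp_write; first by rewrite /= /update /= r7' (layout_n L2) /=; nia.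
  rewrite /= /update /= (layout_sqr L2) (layout_n L2) r11' r7'.
  apply: wp_assign; first by rewrite /= /update /= r11'; lia.
  rewrite /= /update /= r11' r2i (layout_n L2); split=> //.
  exists (rcons K v); split=> //=; rewrite /update /=.
  + have L3 := layout_high (p := n * n + n + n + size K) i (leq_addr _ _) L2.
    have hp : n * n + n + n <= n * n + n + n + n + size K by lia.
    by apply: layout_eq (layout_high (v.+1 * n - n) hp L3) _ _ _ _.
  + by rewrite fr.
  + by rewrite size_rcons addn1.
  + move=> a; rewrite size_rcons ltnS leq_eqVlt /= map_rcons !nth_rcons size_map.
    rewrite !updateE => /orP[/eqP->|ak].
      rewrite ltnn !eqxx /= ifF; last lia.
      by split=> //; lia.
    rewrite ak !ifF; [exact: lK2 | lia | lia | lia | lia].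
  split=> //.
  + by rewrite rcons_uniq uK mK ltnn.
  + exact: (memE true vt).
  + by rewrite size_rcons ltnS.
  + move=> a; rewrite size_rcons ltnS leq_eqVlt map_rcons nth_rcons size_map.
    by case/orP => [/eqP->|ak]; [rewrite ltnn eqxx | rewrite ak; apply: gK].
- move=> s' _ _ [K [L r2 r11 lK [r7 uK mK sK gK]]].
  by exists K; split=> //; split=> // x; rewrite mK ltn_ord.
Qed.

(* The matrix is compacted in place: entry (i, j) moves to i k + j, which is  *)
(* not beyond its old address, so no write hits an entry still to be read.    *)
Lemma wp_emit s X D (K : seq 'I_n) :
    layout s X D -> regs s 11 = size K -> lists s K -> size K <= n ->
    (forall a, a < size K -> a <= nth 0 (map val K) a) ->
  wp M N emit s (fun s' =>
    [/\ regs s' 1 = cap, regs s' 2 = regs s 2, regs s' 11 = size K,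
        regs s' 7 = size K * size K
      & forall a b : 'I_(size K),
          memory s' (a * size K + b) = e (tnth (in_tuple K) a) (tnth (in_tuple K) b)]).
Proof.
move=> L r11 lK kn gK; have [r0 r1 r3 A _ _] := L; set k := size K in r11 kn gK *.
have nthK (a : 'I_k) : nth 0 (map val K) a = tnth (in_tuple K) a.
  by rewrite (tnth_nth (tnth (in_tuple K) a)) (nth_map (tnth (in_tuple K) a)).
apply: wp_seq; apply: wp_assign => //=.
(* From the write position on, memory is unchanged; in particular the lists behind the matrix stay
   readable. *)
pose inv i j s' := [/\ [/\ regs s' 0 = n, regs s' 1 = cap, regs s' 2 = regs s 2
      & regs s' 3 = n * n],
    regs s' 11 = k, regs s' 7 = i * k + j,
    forall q, i * k + j <= q -> memory s' q = memory s q
  & forall a b : 'I_k, a * k + b < i * k + j ->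
      memory s' (a * k + b) = e (tnth (in_tuple K) a) (tnth (in_tuple K) b)].
apply: (wp_for (k := k) (Inv := fun i => inv i 0)) => //=; first lia.
- lia.
- move=> i s1 i_lt s1i s1n [[r0' r1' r2' r3'] _ r7 old new].
  pose x := Ordinal i_lt.
  apply: wp_seq; apply: wp_read; rewrite [eval _ _]/= r3' r0' s1i.
  rewrite old; last by nia.
  have [_ ->] := lK _ i_lt; rewrite (nthK x).
  apply: (wp_for (k := k) (Inv := fun j s' => [/\ regs s' 5 = i,
    regs s' 12 = tnth (in_tuple K) x * n & inv i j s'])) => //=; first lia.
  + lia.
  + move=> j s2 j_lt s2j s2n [s2i r12 [[r0'' r1'' r2'' r3''] _ r7' old' new']].
    pose y := Ordinal j_lt.
    have ijn : i * k + j < n * n by nia.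
    apply: wp_seq; apply: wp_read; rewrite /= r3'' r0'' s2j old'; last by nia.
    have [-> _] := lK _ j_lt; rewrite (nthK y).
    apply: wp_seq; apply: wp_read; rewrite /= /update /= r12 old'; last first.
      have := gK _ i_lt; have := gK _ j_lt; rewrite (nthK x) (nthK y); nia.
    rewrite A; apply: wp_seq; apply: wp_write.
      by rewrite /= /update /=; case: (e _ _); lia.
    rewrite /= /update /= r7'.
    apply: wp_assign; rewrite /= /update /= ?r7'; first lia.
    split=> //; split=> //; split=> //=; rewrite /update /=.
    * lia.
    * by move=> q qij; rewrite ifF; [apply: old'; lia | lia].
    * move=> a b ab; case: eqP => [E|nE]; last by apply: new'; lia.
      have ak := ltn_ord a; have bk := ltn_ord b.
      have Ex : a = x.
        apply/val_inj => /=; have := f_equal (divn^~ k) E.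
        by rewrite !divnMDl ?divn_small ?addn0 //; lia.
      have Ey : b = y by apply/val_inj => /=; move: E; rewrite Ex /=; lia.
      by rewrite Ex Ey.
  + move=> s2 s2j s2n [s2i r12 [rr _ r7' old' new']]; split=> //; split=> //=.
    * by rewrite /update /= r7'; lia.
    * by move=> q iq; apply: old'; lia.
    * by move=> a b ab; apply: new'; lia.
- move=> s' _ _ [[_ r1' r2' _] r11' r7 _ new]; split=> //; first by rewrite r7 addn0.
  move=> a b; apply: new; have := ltn_ord a; have := ltn_ord b; nia.
Qed.

(** The output is the graph induced on the kept vertices. Zeros behind the matrix are asked for only
    when [0 < n], so the lemma also covers an empty graph started on memory left from another
    input. *)
Lemma wp_reduce s :
    regs s 0 = n -> regs s 1 = cap -> regs s 2 = target I ->
    (forall i j : 'I_n, memory s (i * n + j) = e i j) ->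
    (forall p, 0 < n -> n * n <= p -> memory s p = 0) ->
  wp M N reduce s (fun s' => exists J,
    [/\ outputs s' J, yes_instance J <-> yes_instance I, capacity J = cap,
        target J <= (nvert J ^ 2).+1
      & nvert J <= 8 * (vc_number I ^ 2 * cap)]).
Proof.
move=> r0 r1 r2 A Z.
apply: wp_seq; apply: wp_conseq (wp_square r0) _ => s1 [m1 r3 fr].
have L1 : layout s1 set0 set0.
  split; rewrite ?(fr 0) ?(fr 1) ?m1 // => i; have i_lt := ltn_ord i; rewrite Z ?inE //; lia.
apply: wp_seq; apply: wp_conseq (wp_matching L1) _.
move=> s2 [X [L2 t2 r4 Xcover Xvc]].
have {}t2 : regs s2 2 = target I by rewrite t2 fr.
apply: wp_seq; apply: wp_conseq (wp_prune L2 Xcover r4 _) _; first by rewrite t2.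
move=> s3 [D [L3 degs t3 ach3]].
apply: wp_seq; apply: wp_conseq (wp_collect L3) _.
move=> s4 [K [L4 t4 r11 lK [uK mK sK gK]]].
apply: wp_seq; apply: wp_conseq (wp_emit L4 r11 lK sK gK) _.
move=> s5 [r1_5 t5 r11_5 r7 mJ]; set k := size K in r11_5 r7 mJ.
pose h := tnth (in_tuple K).
have hK a : h a \in K by apply: mem_tnth.
have hD a : h a \notin D by move: (hK a); rewrite mK => /existsP[y /and3P[]].
have Jsym : symmetric (fun a b => e (h a) (h b)) by move=> a b; apply: esym.
have Jirr : irreflexive (fun a b => e (h a) (h b)) by move=> a; apply: eirr.
pose tJ := if regs s3 2 - k ^ 2 == 0 then regs s3 2 else (k ^ 2).+1.
pose J := Instance Jsym Jirr cap tJ.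
have tJ_le : tJ <= (k ^ 2).+1 by rewrite /tJ; case: eqP; lia.
have kk : k * k <= n * n by rewrite leq_mul.
have yesJ : yes_instance J <-> yes_instance I.
  rewrite /yes_instance -/(achievable _ _ _) -/(achievable _ _ _) /=.
  rewrite /tJ -(card_ord k) achievable_trunc // -t2 -ach3.
  rewrite -(@achievable_embed _ _ h (delete e D)).
  - by apply: eq_achievable => a b; rewrite /delete !hD !andbT.
  - exact: delete_sym.
  - exact: delete_irr.
  - by apply/tuple_uniqP.
  - exact: cap_gt0.
  - move=> x y exy; have : x \in K by rewrite mK; apply/existsP; exists y.
    by case/(tnthP (in_tuple K)) => a ->; apply: codom_f.
(* With [x = #|X|], positive [cap] gives [k <= x * (x * cap + 1) <= 2 * x ^ 2 * cap], and [x] is at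
   most twice the cover number, which turns 2 into 8. *)
have kvc : k <= 8 * (vc_number I ^ 2 * cap).
  have kX : k <= #|X| * (#|X| * cap).+1.
    have dcover : vertex_cover (delete e D) X.
      apply/forallP => x; apply/forallP => y; apply/implyP => /and3P[exy _ _].
      by have /forallP/(_ x)/forallP/(_ y)/implyP := Xcover; apply.
    have := card_non_isolated (delete_sym D esym) dcover degs.
    suff -> : #|[set x | [exists y, delete e D x y]]| = k by [].
    by rewrite /k -(card_uniqP uK); apply: eq_card => x; rewrite inE mK.
  have Xle : #|X| <= 2 * vc_number I.
    rewrite /vc_number /vc; case: arg_minnP => [|S Scover _]; last exact: Xvc.
    by apply/forallP => x; apply/forallP => y; rewrite inE implybT.
  case: (posnP n) => [n0 | n_gt0].
    by apply: leq_trans sK _; rewrite n0.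
  have c_gt0 := cap_gt0 (Ordinal n_gt0); apply: leq_trans kX _.
  apply: leq_trans (_ : 2 * (#|X| * #|X| * cap) <= _).
    by move: #|X| c_gt0 => x; nia.
  have := leq_mul Xle Xle; rewrite -mulnn; move: #|X| (vc_number I) => x w; nia.
have out s' : regs s' 0 = k -> regs s' 1 = cap -> regs s' 2 = tJ ->
    memory s' = memory s5 -> exists J,
    [/\ outputs s' J, yes_instance J <-> yes_instance I, capacity J = cap,
        target J <= (nvert J ^ 2).+1 & nvert J <= 8 * (vc_number I ^ 2 * cap)].
  move=> r0' r1' r2' m'; exists J; split=> //=; split=> // p.
  rewrite /= -mulnn => pk; have k_gt0 : 0 < k by lia.
  have ik : p %/ k < k by rewrite ltn_divLR.
  have jk : p %% k < k by rewrite ltn_mod.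
  rewrite (divn_eq p k) m' (mJ (Ordinal ik) (Ordinal jk)).
  by rewrite -(adj_cellE (I := J) (Ordinal ik) (Ordinal jk)).
have t5' : regs s5 2 = regs s3 2 by rewrite t5 t4.
apply: wp_seq; apply: wp_if => /=; rewrite r7 t5' => t.
  apply: wp_assign; rewrite /= r7; first lia.
  apply: wp_assign; rewrite /= /update /= r11_5; first lia.
  by apply: out; rewrite //= /update /= /tJ -mulnn; case: eqP => // _; rewrite addn1.
apply: wp_skip; apply: wp_assign; rewrite /= r11_5; first lia.
by apply: out; rewrite //= /update /= /tJ -mulnn t.
Qed.

End Correctness.

(** * The complete algorithm and its running time *)

(** With capacity 0 and at least one vertex no partition is admissible; the input is then replaced
    by the empty graph with target 1, also a no-instance. *)
Definition kernelize : cmd :=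
  Seq (If (Reg 1) Skip
         (If (Reg 0) (Seq (Assign 0 (Const 0)) (Assign 2 (Const 1))) Skip))
      reduce.

(** Bounds all values stored in a run: [nvert I * nvert I] covers matrix addresses,
    [nvert I * capacity I] the degree threshold. *)
Definition value_bound (I : instance) : nat :=
  nvert I * nvert I + 4 * nvert I + nvert I * capacity I + capacity I + target I + 3.

Lemma bounded_input (I : instance) : bounded (value_bound I) (input_state I).
Proof.
have M_gt0 : 0 < value_bound I by rewrite /value_bound; lia.
split=> //= [[|[|[|x]]]|p] /=; rewrite /value_bound ?nth_nil; try lia.
by rewrite /adj_cell; case: [exists _, _]; lia.
Qed.

Lemma no_instance_cap0 (I : instance) :
  capacity I = 0 -> 0 < nvert I -> ~ yes_instance I.
Proof.
move=> c0 n_gt0 /(achievableP (@adj_sym I) (@adj_irr I)) [L [f [fcap _]]].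
pose x := Ordinal n_gt0.
have := fcap (f x); rewrite c0 leqn0 cards_eq0 => /eqP/setP/(_ x).
by rewrite !inE eqxx.
Qed.

Lemma wp_kernelize (I : instance) :
  wp (value_bound I) (nvert I) kernelize (input_state I) (fun s' => exists J,
    [/\ outputs s' J, yes_instance J <-> yes_instance I, capacity J = capacity I,
        target J <= (nvert J ^ 2).+1
      & nvert J <= 8 * (vc_number I ^ 2 * capacity I)]).
Proof.
have direct : (0 < nvert I -> 0 < capacity I) ->
  wp (value_bound I) (nvert I) reduce (input_state I) (fun s' => exists J,
    [/\ outputs s' J, yes_instance J <-> yes_instance I, capacity J = capacity I,
        target J <= (nvert J ^ 2).+1
      & nvert J <= 8 * (vc_number I ^ 2 * capacity I)]).
  move=> c_gt0; apply: wp_reduce => //=.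
  - by rewrite /value_bound; lia.
  - by case=> i i_lt; apply: c_gt0; apply: leq_ltn_trans i_lt.
  - exact: adj_cellE.
  - by move=> p _; apply: adj_cell_out.
apply: wp_seq; apply: wp_if => /= c0.
  by apply: wp_skip; apply: direct; lia.
apply: wp_if => /= n0; last by apply: wp_skip; apply: direct; lia.
apply: wp_seq; apply: wp_assign => //; apply: wp_assign; first by rewrite /= /value_bound; lia.
(* The empty graph, on which [reduce] is run with the matrix of [I] still in memory. *)
pose J0 := @Instance 0 (fun _ _ => false) (fun _ _ => erefl) (fun _ => erefl)
  (capacity I) 1.
have noJ0 : ~ yes_instance J0.
  move/(achievable_leq_sqr (@adj_sym J0) (@adj_irr J0)).
  by rewrite card_ord.
apply: wp_conseq (@wp_reduce J0 _ _ _ _ _ _ _ _ _ _ _) _ => //=.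
- by rewrite /value_bound c0; lia.
- by case.
- by case.
move=> s' [J [oJ yJ cJ tJ]]; rewrite c0 !muln0 => nJ; exists J; split=> //; last by rewrite cJ.
rewrite yJ; split=> // yI; exfalso; apply: no_instance_cap0 yI => //; lia.
Qed.

(** With [B = 2 ^ instance_size I], all three numbers lie below [B] and [8 <= B], so the sum is
    below [B ^ 3]. *)
Lemma bitlen_value_bound (I : instance) :
  bitlen (value_bound I) <= 3 * instance_size I.
Proof.
apply: bitlen_leq; first by rewrite /instance_size /bitlen; lia.
set b := instance_size I.
have lt2b k : bitlen k <= b -> k < 2 ^ b.
  by move=> kb; apply: leq_trans (ltn_bitlen k) _; rewrite leq_exp2l.
have := lt2b (nvert I); have := lt2b (capacity I); have := lt2b (target I).
have : 2 ^ 3 <= 2 ^ b by rewrite leq_exp2l // /b /instance_size /bitlen; lia.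
have [bn bc bt] : [/\ bitlen (nvert I) <= b, bitlen (capacity I) <= b
    & bitlen (target I) <= b] by rewrite /b /instance_size; split; lia.
move=> B8 /(_ bt) + /(_ bc) + /(_ bn); rewrite /value_bound (mulnC 3) expnM.
set B := 2 ^ b in B8 *; move: (nvert I) (capacity I) (target I) => n c t nB cB tB.
have nn : n * n <= B * B by rewrite leq_mul // ltnW.
have nc : n * c <= B * B by rewrite leq_mul // ltnW.
have : 8 * (B * B) <= B ^ 3 by rewrite expnS -mulnn leq_mul2r B8 orbT.
have : 8 * B <= B * B by rewrite leq_mul2r B8 orbT.
by move: nn nc; move: (n * n) (n * c) (B * B) (B ^ 3) => u v w z; lia.
Qed.

Theorem theorem1p5 :
  exists f : instance -> instance,
    kernel f /\
    exists c : nat, forall I : instance,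
      nvert (f I) <= c * (vc_number I ^ 2 * capacity I).
Proof.
have spec I : exists J, (exists t s, [/\ exec kernelize (input_state I) t s,
      outputs s J & t <= time_bound (nvert I) kernelize * bitlen (value_bound I)]) /\
    [/\ yes_instance J <-> yes_instance I, capacity J = capacity I,
        target J <= (nvert J ^ 2).+1
      & nvert J <= 8 * (vc_number I ^ 2 * capacity I)].
  have [t [s [ex T _ [J [oJ yJ cJ tJ nJ]]]]] := wp_kernelize (bounded_input I).
  by exists J; split=> //; exists t, s.
(* Choice only names the instance that the program outputs; polynomial time is witnessed by
   [kernelize] itself. *)
pose f I := proj1_sig (constructive_indefinite_description _ (spec I)).
have fP I := proj2_sig (constructive_indefinite_description _ (spec I)).
exists f; split; last by exists 8 => I; have [_ []] := fP I.
split; last 1 first.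
(* The cover number and the capacity are each at most the parameter, hence the cube. *)
- pose k p := 8 * p ^ 3.
  exists (fun p => k p ^ 2 + bitlen (k p) + bitlen p + bitlen (k p ^ 2).+1) => I.
  have [_ [_ cJ tJ nJ]] := fP I; rewrite -/(f I) in cJ tJ nJ.
  have ck : capacity (f I) <= parameter I by rewrite cJ /parameter leq_addl.
  have nk : nvert (f I) <= k (parameter I).
    apply: leq_trans nJ _; rewrite /k leq_mul2l /= [_ ^ 3]expnSr leq_mul ?leq_addl //.
    by rewrite leq_exp2r // leq_addr.
  have n2k : nvert (f I) ^ 2 <= k (parameter I) ^ 2 by rewrite leq_exp2r.
  rewrite /instance_size !leq_add ?bitlen_mono //.
  by apply: leq_trans tJ _; rewrite ltnS.
- have [K [d Kd]] := time_bound_poly kernelize.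
  (* [K] and [d] come from the loops; the factor 3 and the extra degree come from the bit length of
     [value_bound I]. *)
  exists kernelize, (K * 3), d.+1 => I.
  have [[t [s [ex oJ T]]] _] := fP I; exists t, s; split=> //.
  apply: leq_trans T _; rewrite expnSr mulnACA.
  apply: leq_mul (bitlen_value_bound I); apply: leq_trans (Kd _) _.
  rewrite leq_mul2l; apply/orP; right.
  have [->|d_gt0] := posnP d; first by rewrite !expn0.
  by rewrite leq_exp2r // /instance_size /bitlen; nia.
- by move=> I; have [_ []] := fP I.
Qed.
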